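(* There exists a numerical constant $c>0$ (i.e., an absolute constant, not depending on $n$, $N$, $K$, $\varepsilon$, $\bm{z}$ or the distributions of the random vectors below) such that the following holds. Let $n,N\ge 1$ be integers, and let $\bm{w}_1,\dots,\bm{w}_N$ be independent sub-Gaussian random vectors in $\mathbb{R}^n$ (not necessarily identically distributed, isotropic, or having the same second moment matrix) whose sub-Gaussian norms are all bounded by $K$, i.e. $\|\bm{w}_j\|_{\varphi_2}\le K$ for all $j=1,\dots,N$. Let $$\bm{D}:=\frac1N\sum_{j=1}^N \bm{w}_j\bm{w}_j{}'-\frac1N\sum_{j=1}^N\mathbb{E}[\bm{w}_j\bm{w}_j{}'].$$ Then for every $\varepsilon>0$: 1. for any given (fixed, deterministic) vector $\bm{z}\in\mathbb{R}^n$, with probability at least $1-2\exp(-c\min(\varepsilon,\varepsilon^2)N)$, $$|\bm{z}'\bm{D}\bm{z}|\le 4\varepsilon K^2\|\bm{z}\|^2;$$ 2. with probability at least $1-2\exp(n\log 9-c\min(\varepsilon,\varepsilon^2)N)$, $$\|\bm{D}\|\le 4\varepsilon K^2.$$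
   Context: Here $'$ denotes transpose; $\|\cdot\|$ denotes the Euclidean ($l_2$) norm of a vector and the induced $l_2$ operator norm (spectral norm) of a matrix; $\log$ is the natural logarithm. A real random variable $x$ is sub-Gaussian if there exists a constant $K_g$ such that $\mathbb{E}[|x|^p]^{1/p}\le K_g\sqrt{p}$ for all integers $p\ge 1$; the smallest such $K_g$ is its sub-Gaussian norm, $\|x\|_{\varphi_2}=\sup_{p\ge1}p^{-1/2}\,\mathbb{E}[|x|^p]^{1/p}$. A random vector $\bm{x}$ in $\mathbb{R}^n$ is sub-Gaussian if $\bm{x}'\bm{z}$ is sub-Gaussian for every unit norm vector $\bm{z}\in\mathbb{R}^n$, and its sub-Gaussian norm is $\|\bm{x}\|_{\varphi_2}=\sup_{\bm{z}:\|\bm{z}\|=1}\|\bm{x}'\bm{z}\|_{\varphi_2}$. No centering (zero mean) is assumed. A random vector $\bm{w}$ is isotropic if $\mathbb{E}[\bm{w}\bm{w}']$ is the identity matrix. *)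

(* Defs.v *)
From HB Require Import structures.
From mathcomp Require Import all_boot all_order all_algebra.
From mathcomp Require Import all_classical all_reals all_analysis.
Set Implicit Arguments.
Unset Strict Implicit.
Unset Printing Implicit Defensive.
Import Order.TTheory GRing.Theory Num.Theory.
Import numFieldNormedType.Exports.
Local Open Scope classical_set_scope.
Local Open Scope ring_scope.

(* MathComp-Analysis, over an arbitrary [R : realType]; vectors of R^n are
   columns ['cV[R]_n].  The library norm [`|z|] on matrices is the max norm,
   hence the Euclidean and spectral norms below. *)

Definition l2norm (R : realType) (n : nat) (z : 'cV[R]_n) : R :=
  Num.sqrt (\sum_(i < n) z i 0 ^+ 2).

(* A supremum in [R]; by [has_sup_opnorm] it is a genuine one when 0 < n. *)
Definition opnorm (R : realType) (m n : nat) (A : 'M[R]_(m, n)) : R :=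
  sup [set l2norm (A *m z) | z in [set z : 'cV[R]_n | l2norm z = 1]].

Lemma has_sup_opnorm (R : realType) (m n : nat) (A : 'M[R]_(m, n)) :
  (0 < n)%N ->
  has_sup [set l2norm (A *m z) | z in [set z : 'cV[R]_n | l2norm z = 1]].
Proof.
move=> n_gt0; split.
  pose e : 'cV[R]_n := delta_mx (Ordinal n_gt0) 0.
  exists (l2norm (A *m e)), e => //=.
  rewrite /l2norm (bigD1 (Ordinal n_gt0)) //= big1 => [|i /negbTE ni].
    by rewrite addr0 mxE !eqxx expr1n sqrtr1.
  by rewrite mxE ni /= expr0n.
exists (Num.sqrt (\sum_(i < m) (\sum_(j < n) `|A i j|) ^+ 2)).
move=> _ [z /= z1 <-]; apply: ler_wsqrtr; apply: ler_sum => i _.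
have zj1 (j : 'I_n) : `|z j 0| <= 1.
  rewrite -z1 -sqrtr_sqr; apply: ler_wsqrtr.
  by rewrite (bigD1 j) //= lerDl sumr_ge0 // => k _; rewrite sqr_ge0.
rewrite -real_normK ?num_real // ler_sqr ?nnegrE ?sumr_ge0 // mxE.
apply: le_trans (ler_norm_sum _ _ _) _; apply: ler_sum => j _.
by rewrite normrM ler_piMr.
Qed.

(* R^n with its Borel sigma-algebra. *)
Definition borel_cV (R : realType) (n : nat) :=
  g_sigma_algebraType (@open 'cV[R]_n).

Definition random_vector (d : measure_display) (T : measurableType d)
    (R : realType) (n : nat) (w : T -> 'cV[R]_n) : Prop :=
  measurable_fun [set: T] (w : T -> borel_cV R n).

Definition mutually_independent (d : measure_display) (T : measurableType d)
    (R : realType) (P : probability T R) (n : nat) (I : finType)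
    (w : I -> T -> 'cV[R]_n) : Prop :=
  forall (J : {set I}) (B : I -> set (borel_cV R n)),
    (forall i, i \in J -> measurable (B i)) ->
    P (\bigcap_(i in [set` J]) (w i @^-1` B i)) =
      (\prod_(i in J) P (w i @^-1` B i))%E.

Definition dotv (R : realType) (n : nat) (x z : 'cV[R]_n) : R :=
  (x^T *m z) 0 0.

(* ['N[P]_p[X]] is E[|X|^p]^(1/p), with values in [0, +oo]. *)
Definition sub_gaussian (d : measure_display) (T : measurableType d)
    (R : realType) (P : probability T R) (X : T -> R) : Prop :=
  exists Kg : R, forall p : nat, (1 <= p)%N ->
    ('N[P]_(p%:R%:E)[EFin \o X] <= (Kg * Num.sqrt p%:R)%:E)%E.

Definition sub_gaussian_norm (d : measure_display) (T : measurableType d)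
    (R : realType) (P : probability T R) (X : T -> R) : \bar R :=
  ereal_sup [set ((Num.sqrt p%:R)^-1%:E * 'N[P]_(p%:R%:E)[EFin \o X])%E
            | p in [set p : nat | (1 <= p)%N]].

Definition sub_gaussian_vector (d : measure_display) (T : measurableType d)
    (R : realType) (P : probability T R) (n : nat) (w : T -> 'cV[R]_n) : Prop :=
  forall z : 'cV[R]_n, l2norm z = 1 -> sub_gaussian P (fun t => dotv (w t) z).

Definition sub_gaussian_vector_norm (d : measure_display)
    (T : measurableType d) (R : realType) (P : probability T R) (n : nat)
    (w : T -> 'cV[R]_n) : \bar R :=
  ereal_sup [set sub_gaussian_norm P (fun t => dotv (w t) z)
            | z in [set z : 'cV[R]_n | l2norm z = 1]].

(* [fine] only discards infinite entries; they are finite for sub-Gaussian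
   vectors. *)
Definition second_moment (d : measure_display) (T : measurableType d)
    (R : realType) (P : probability T R) (n : nat) (w : T -> 'cV[R]_n) :
    'M[R]_n :=
  \matrix_(i, k) fine ('E_P[fun t => (w t *m (w t)^T) i k])%E.

Definition second_moment_deviation (d : measure_display)
    (T : measurableType d) (R : realType) (P : probability T R) (n N : nat)
    (w : 'I_N -> T -> 'cV[R]_n) (t : T) : 'M[R]_n :=
  N%:R^-1 *: (\sum_(j < N) w j t *m (w j t)^T)
  - N%:R^-1 *: (\sum_(j < N) second_moment P (w j)).

(* Main.v *)
Require Import Defs.
From HB Require Import structures.
From mathcomp Require Import all_boot all_order all_algebra.
From mathcomp Require Import all_classical all_reals all_analysis.
From mathcomp Require Import measurable_realfun lra ring.
Set Implicit Arguments.
Unset Strict Implicit.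
Unset Printing Implicit Defensive.
Import Order.TTheory GRing.Theory Num.Theory.
Import numFieldNormedType.Exports.
Local Open Scope classical_set_scope.
Local Open Scope ring_scope.

(** For a unit vector z the variables (w_j' z)^2 have k-th moments at most
    (2 K^2 k)^k, hence are sub-exponential; a Bernstein-type bound on their
    moment generating functions and Chernoff's method give part 1.  For part 2,
    z ranges over a grid in the unit ball with at most 2^(18 n) points, on which
    the quadratic form controls half of the operator norm.  Replacing the sharp
    cardinality 9^n (which needs a volume argument) by 2^(18 n) <= 9^(9 n) is
    harmless: the bound is vacuous unless n log 9 < c min(eps, eps^2) N, and in
    that range the excess is absorbed by taking c ten times smaller.  K = 0 is
    the limit of K > 0. *)

(** * Moment generating functions *)

(** The squares (w_j' z)^2 are not centred. Their means are kept exactly in the exponent of both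
    one-sided exponential bounds, with an error of second order only, so they cancel in the
    deviation event. Independence is given for events alone. The product bound for expectations is
    obtained from it through simple functions and monotone convergence, and an inequality suffices
    there. Passing from a bad event to the good one uses measurability of the latter. For the
    operator norm, a supremum over uncountably many vectors, this comes from testing rational
    vectors only. The constant is 1280 = 32 * 4 * 10: 32 is the optimum of the Chernoff exponent, 4
    is the price of running the net at [eps / 2], and 10 absorbs the size of the net. *)

(** k^k k! <= (2k)! = C(2k,k) k!^2, and C(2k,k) is one term of the expansion of (1+1)^(2k). After
    division by k!, moments of size (a k)^k become the geometric terms (4a)^k. *)
Lemma leq_expn_fact (k : nat) : (k ^ k <= 4 ^ k * k`!)%N.
Proof.
have aux m i : (m ^ i * m`! <= (m + i)`!)%N.
  elim: i => [|i IH]; first by rewrite expn0 mul1n addn0.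
  rewrite expnS addnS factS -mulnA leq_mul//.
  by rewrite -addnS leq_addr.
rewrite -(leq_pmul2r (fact_gt0 k)) (leq_trans (aux k k))//.
have kk : (k <= k + k)%N by rewrite leq_addr.
rewrite -(bin_fact kk) addnK -mulnA leq_pmul2r ?muln_gt0 ?fact_gt0//.
rewrite (_ : 4 = 2 ^ 2)%N// -expnM mul2n -addnn.
have := expnDn 1 1 (k + k); rewrite addn1 => ->.
rewrite (bigD1 (Ordinal (leq_addr k k : k < (k + k).+1)%N))//=.
by rewrite !exp1n !muln1 leq_addr.
Qed.

(** From exp(x) >= 1 + x it is enough that (1 - x + x^2)(1 + x) = 1 + x^3 is at least 1. *)
Lemma expRN_le_quadratic (R : realType) (x : R) :
  0 <= x -> expR (- x) <= 1 - x + x ^+ 2.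
Proof.
move=> x0; rewrite expRN.
have x1 : 0 < 1 + x by rewrite ltr_pwDl.
apply: (@le_trans _ _ (1 + x)^-1).
  by rewrite lef_pV2 ?posrE ?expR_gt0// expR_ge1Dx.
rewrite -(ler_pM2r x1) mulVf ?gt_eqF//.
have -> : (1 - x + x ^+ 2) * (1 + x) = 1 + x ^+ 3 by ring.
by rewrite lerDl exprn_ge0.
Qed.

Lemma geometric_tail_le (R : realFieldType) (x : R) (n : nat) :
  0 <= x -> x <= 2^-1 -> \sum_(2 <= k < n) x ^+ k <= 2 * x ^+ 2.
Proof.
move=> x0 x1; have [n2|n2] := leqP n 2.
  by rewrite big_geq// mulr_ge0// exprn_ge0.
(* The subtracted term makes the induction close: x^(n+1) <= x^n / 2 pays for the new summand. *)
suff : \sum_(2 <= k < n) x ^+ k <= 2 * x ^+ 2 - 2 * x ^+ n.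
  by have := exprn_ge0 n x0; lra.
elim: n n2 => // n IH; rewrite ltnS leq_eqVlt => /predU1P[<-|n2].
  rewrite big_nat1 -subr_ge0.
  have -> : 2 * x ^+ 2 - 2 * x ^+ 3 - x ^+ 2 = x ^+ 2 * (1 - 2 * x) by ring.
  by rewrite mulr_ge0 ?exprn_ge0//; lra.
rewrite big_nat_recr/=; last exact: ltnW.
have h := IH n2.
have : x ^+ n.+1 <= 2^-1 * x ^+ n by rewrite exprS ler_wpM2r// exprn_ge0.
lra.
Qed.

Section mgf.
Context (R : realType) d (T : measurableType d) (P : probability T R).
Local Open Scope ereal_scope.

(** In the integrated exponential series the first two terms are exactly 1 + m and the k-th is at
    most (4a)^k. As 4a <= 1/2, the tail is at most 2 (4a)^2 = 32 a^2, and 1 + y <= exp(y)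
    concludes. *)
Lemma mgf_le (X : T -> R) (m a : R) :
  measurable_fun setT X -> (forall t, 0 <= X t)%R ->
  (0 <= a)%R -> (8 * a <= 1)%R ->
  \int[P]_t (X t)%:E = m%:E ->
  (forall k, (2 <= k)%N -> \int[P]_t (X t ^+ k)%:E <= ((a * k%:R) ^+ k)%:E) ->
  \int[P]_t (expR (X t))%:E <= (expR (m + 32 * a ^+ 2))%:E.
Proof.
move=> mX X0 a0 a8 Em Ek.
pose S n t := (\sum_(0 <= k < n) exp_coeff (X t) k)%:E.
have coef0 k t : (0 <= exp_coeff (X t) k)%R by exact: exp_coeff_ge0.
have mXk k : measurable_fun setT (EFin \o (fun t => (X t ^+ k)%R : R)).
  by apply/measurable_EFinP; exact: measurable_funX.
have mcoef k : measurable_fun setT (EFin \o (fun t => exp_coeff (X t) k : R)).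
  apply/measurable_EFinP; rewrite /exp_coeff/=.
  by apply: measurable_funM => //; exact: measurable_funX.
have mS n : measurable_fun setT (S n).
  apply/measurable_EFinP; apply: measurable_sum => k.
  exact/measurable_EFinP/mcoef.
have -> : \int[P]_t (expR (X t))%:E = limn (fun n => \int[P]_t S n t).
  rewrite -monotone_convergence//.
  - apply: eq_integral => t _; apply/esym/cvg_lim => //.
    apply: cvg_EFin; first exact: nearW.
    exact: is_cvg_series_exp_coeff.
  - by move=> n t _; rewrite lee_fin sumr_ge0.
  - by move=> t _ p q pq; rewrite lee_fin; exact: nondecreasing_series.
have SE n : \int[P]_t S n t = \sum_(0 <= k < n) (k`!%:R^-1)%:E * \int[P]_t (X t ^+ k)%:E.
  rewrite /S; under eq_integral do rewrite -sumEFin.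
  rewrite ge0_integral_sum//; last by move=> k t _; rewrite lee_fin.
  apply: eq_bigr => k _.
  rewrite -ge0_integralZl_EFin//.
    by apply: eq_integral => t _; rewrite /exp_coeff/= mulrC EFinM.
    by move=> t _; rewrite lee_fin exprn_ge0.
  exact: mXk.
have bnd n : \int[P]_t S n t <= (expR (m + 32 * a ^+ 2))%:E.
  (* Two more terms guarantee that the terms of order 0 and 1 are there to be split off. *)
  have S2 : \int[P]_t S n t <= \int[P]_t S n.+2 t.
    apply: ge0_le_integral => //.
    - by move=> t _; rewrite lee_fin sumr_ge0.
    - by move=> t _; rewrite lee_fin; apply: nondecreasing_series => //; exact: leqW.
  apply: (le_trans S2); rewrite SE big_ltn// big_ltn// fact0 invr1 mul1e.
  under eq_integral do rewrite expr0.
  rewrite integral_cst//= probability_setT !mul1e.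
  under eq_integral do rewrite expr1.
  rewrite Em.
  apply: (@le_trans _ _ (1 + (m%:E + (\sum_(2 <= k < n.+2) (4 * a) ^+ k)%:E))).
    rewrite leeD2l// leeD2l// -sumEFin big_nat_cond [leRHS]big_nat_cond.
    apply: lee_sum => k; rewrite andbT => /andP[k2 _].
    apply: (@le_trans _ _ ((k`!%:R^-1)%:E * ((a * k%:R) ^+ k)%:E)).
      by rewrite lee_pmul2l ?lte_fin// ?invr_gt0 ?ltr0n ?fact_gt0// Ek.
    rewrite -EFinM lee_fin ler_pdivrMl ?ltr0n ?fact_gt0//.
    rewrite !exprMn mulrCA mulrA [leRHS]mulrC; apply: ler_wpM2l.
      by rewrite exprn_ge0.
    by rewrite -!natrX -natrM ler_nat leq_expn_fact.
  rewrite -!EFinD lee_fin addrA (le_trans _ (expR_ge1Dx _))// addrA lerD2l.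
  apply: (le_trans (geometric_tail_le _ _ _)); [by rewrite mulr_ge0|lra|].
  rewrite exprMn; lra.
apply: lime_le; last exact: nearW.
apply: ereal_nondecreasing_is_cvgn => p q pq.
apply: ge0_le_integral => //.
- by move=> t _; rewrite lee_fin sumr_ge0.
- by move=> t _; rewrite lee_fin; exact: nondecreasing_series.
Qed.

(** The series of exp(-X) alternates, so the quadratic majorant replaces it and a second moment is
    enough. The constant 32 is generous here; it lets both tails share one exponent. *)
Lemma mgfN_le (X : T -> R) (m a : R) :
  measurable_fun setT X -> (forall t, 0 <= X t)%R ->
  \int[P]_t (X t)%:E = m%:E ->
  \int[P]_t (X t ^+ 2)%:E <= ((a * 2) ^+ 2)%:E ->
  \int[P]_t (expR (- X t))%:E <= (expR (- m + 32 * a ^+ 2))%:E.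
Proof.
move=> mX X0 Em E2.
have mX2 : measurable_fun setT (EFin \o (fun t => (X t ^+ 2)%R : R)).
  by apply/measurable_EFinP; exact: measurable_funX.
have mXE : measurable_fun setT (EFin \o X) by exact/measurable_EFinP.
have mE : measurable_fun setT (EFin \o (fun t => expR (- X t) : R)).
  apply/measurable_EFinP; apply: measurableT_comp => //.
  exact: measurable_funN.
(* With X moved to the left both sides are nonnegative, so the integrals split without
   integrability; the finite mean is subtracted afterwards. *)
have : \int[P]_t ((expR (- X t))%:E + (X t)%:E) <= \int[P]_t (1 + (X t ^+ 2)%:E).
  apply: ge0_le_integral => //.
  - by move=> t _; rewrite lee_fin addr_ge0// expR_ge0.
  - exact: emeasurable_funD.
  - exact: emeasurable_funD.
  - move=> t _; rewrite lee_fin; have := expRN_le_quadratic (X0 t); lra.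
rewrite ge0_integralD//; last by move=> t _; rewrite lee_fin.
rewrite ge0_integralD//; last by move=> t _; rewrite lee_fin exprn_ge0.
rewrite integral_cst//= probability_setT mul1e Em.
move=> h; have {h} := le_trans h (leeD2l _ E2).
rewrite -leeBrDr// -!EFinD => /le_trans; apply.
rewrite lee_fin (le_trans _ (expR_ge1Dx _))// exprMn; have := sqr_ge0 a; lra.
Qed.

End mgf.

(** * Independence *)

Section independence.
Context (R : realType) d (T : measurableType d) (P : probability T R).

Lemma integral_sum_indic (I : finType) (c : I -> R) (A : I -> set T) :
  (forall i, 0 <= c i) -> (forall i, measurable (A i)) ->
  (\int[P]_t (\sum_i c i * \1_(A i) t)%:E = (\sum_i c i * fine (P (A i)))%:E)%E.
Proof.
move=> c0 mA; under eq_integral do rewrite -sumEFin.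
have mindic i : measurable_fun setT (EFin \o (fun t => \1_(A i) t : R)).
  by apply/measurable_EFinP; exact: measurable_indic.
rewrite ge0_integral_sum//; first last.
- by move=> i t _; rewrite lee_fin mulr_ge0// indicE.
- move=> i; under eq_fun do rewrite EFinM.
  by apply: emeasurable_funM => //; exact: mindic.
rewrite -sumEFin; apply: eq_bigr => i _.
under eq_integral do rewrite EFinM.
rewrite ge0_integralZl_EFin//; last exact: mindic.
by rewrite integral_indic// setIT EFinM fineK// fin_num_measure.
Qed.

Context (n : nat) (I : finType) (w : I -> T -> 'cV[R]_n).
Hypothesis mw : forall i, random_vector (w i).
Hypothesis indep : mutually_independent P w.

Let m_preim i (B : set (borel_cV R n)) : measurable B -> measurable (w i @^-1` B).
Proof. by move=> mB; rewrite -[X in measurable X]setTI; exact: mw. Qed.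

(** Distributing the product over the sums gives one term per choice function [phi], a constant
    times the indicator of an intersection of preimages. Independence factors its probability, and
    the same distributivity folds the result back. *)
Lemma integral_prod_simple (J : finType) (r : I -> J -> R)
    (C : I -> J -> set (borel_cV R n)) :
  (forall i k, 0 <= r i k) -> (forall i k, measurable (C i k)) ->
  (\int[P]_t (\prod_i \sum_k r i k * \1_(C i k) (w i t))%:E =
   (\prod_i \sum_k r i k * fine (P (w i @^-1` C i k)))%:E)%E.
Proof.
move=> r0 mC.
pose A (phi : {ffun I -> J}) :=
  \bigcap_(i in [set` [set: I]%SET]) (w i @^-1` C i (phi i)).
have mA phi : measurable (A phi).
  apply: fin_bigcap_measurable => // i _; apply: m_preim; exact: mC.
under eq_integral => t _.
  rewrite bigA_distr_bigA (eq_bigr (fun phi : {ffun I -> J} =>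
      (\prod_i r i (phi i)) * \1_(A phi) t)); last first.
    move=> phi _; rewrite big_split/=; congr (_ * _).
    rewrite indicE; have [|] := boolP (t \in A phi); rewrite ?inE ?notin_setE => At.
      rewrite big1// => i _; rewrite indicE mem_set//.
      by apply: (At i); rewrite /= inE.
    have [i /= nAi] : exists i, ~ (w i @^-1` C i (phi i)) t.
      by apply: contrapT => /forallNP h; apply: At => i _; apply: contrapT; exact: h.
    by rewrite (bigD1 i)//= indicE memNset// mul0r.
  over.
rewrite integral_sum_indic => [|phi|//]; last by rewrite prodr_ge0.
congr EFin; rewrite bigA_distr_bigA; apply: eq_bigr => phi _.
rewrite big_split/=; congr (_ * _).
rewrite /A indep; last by move=> i _; exact: mC.
rewrite (eq_bigr (fun i => (fine (P (w i @^-1` C i (phi i))))%:E)).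
  by rewrite prodEFin/=; apply: eq_bigl => i; rewrite inE.
by move=> i _; rewrite fineK// fin_num_measure//; apply: m_preim; exact: mC.
Qed.

(** [approx] is a sum over dyadic slices plus a separate truncation term at height [m]. The last
    index carries that term, which yields one sum of the shape needed by [integral_prod_simple]. *)
Let dyadic_level m (k : 'I_(m * 2 ^ m).+1) : R :=
  if (k < m * 2 ^ m)%N then k%:R / 2 ^+ m else m%:R.

Let dyadic_set (g : borel_cV R n -> R) m (k : 'I_(m * 2 ^ m).+1) :=
  if (k < m * 2 ^ m)%N then dyadic_approx setT (EFin \o g) m k
  else integer_approx setT (EFin \o g) m.

Let dyadic_setP g m x :
  approx setT (EFin \o g) m x =
  \sum_(k < (m * 2 ^ m).+1) dyadic_level k * \1_(dyadic_set g k) x.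
Proof.
rewrite big_ord_recr/= /dyadic_level /dyadic_set/= ltnn; congr (_ + _).
by apply: eq_bigr => i _ /=; rewrite ltn_ord.
Qed.

Let measurable_dyadic_set g m (k : 'I_(m * 2 ^ m).+1) :
  measurable_fun setT g -> measurable (dyadic_set g k).
Proof.
move=> /measurable_EFinP mg; rewrite /dyadic_set; case: ifPn => km.
  rewrite /dyadic_approx km -preimage_comp.
  by apply: mg => //; apply/measurable_image_EFin; exact: measurable_itv.
exact: emeasurable_fun_c_infty.
Qed.

(** Dyadic approximations of the [g i] increase to them, so their products increase to the product
    and monotone convergence applies. At each level the product rule is exact and every factor is at
    most [b i]. Real bounds [b i] avoid products of possibly infinite integrals. *)
Lemma integral_prod_le (g : I -> borel_cV R n -> R) (b : I -> R) :
  (forall i, measurable_fun setT (g i)) -> (forall i x, 0 <= g i x) ->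
  (forall i, \int[P]_t (g i (w i t))%:E <= (b i)%:E)%E ->
  (\int[P]_t (\prod_i g i (w i t))%:E <= (\prod_i b i)%:E)%E.
Proof.
move=> mg g0 gb.
pose h i m x := approx setT (EFin \o g i) m x.
have h0 i m x : 0 <= h i m x.
  by rewrite /h /approx addr_ge0// ?sumr_ge0// => *; rewrite mulr_ge0// ?indicE.
have g0E i x : setT x -> (0 <= (EFin \o g i) x)%E by rewrite /= lee_fin.
have hg i m x : h i m x <= g i x.
  by rewrite -lee_fin; exact: (@le_approx _ _ _ _ (EFin \o g i) m x (g0E i)).
have nd_h i x : {homo (h i)^~ x : p q / (p <= q)%N >-> p <= q}.
  by move=> p q pq; have /lefP := @nd_approx _ _ _ setT (EFin \o g i) _ _ pq; apply.
have mgw i : measurable_fun setT (fun t => g i (w i t)).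
  exact: (measurableT_comp (mg i) (mw i)).
have mhw i m : measurable_fun setT (fun t => h i m (w i t)).
  rewrite /h; under eq_fun do rewrite dyadic_setP.
  apply: measurable_sum => k; apply: measurable_funM => //.
  apply: (measurableT_comp _ (mw i)).
  by apply: measurable_indic; exact: measurable_dyadic_set.
have lim t : (\prod_i h i m (w i t))%:E @[m --> \oo] --> (\prod_i g i (w i t))%:E.
  apply: cvg_EFin; first exact: nearW.
  apply: cvg_big => [|i _]; first exact: mul_continuous.
  by apply: (@cvg_approx _ _ _ _ (EFin \o g i) (w i t) (g0E i)) => //=; rewrite ltry.
have mprod m : measurable_fun setT (EFin \o (fun t => \prod_i h i m (w i t) : R)).
  by apply/measurable_EFinP; apply: measurable_prod => i _; exact: mhw.
have -> : (\int[P]_t (\prod_i g i (w i t))%:E)%E =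
    limn (fun m => \int[P]_t (\prod_i h i m (w i t))%:E)%E.
  rewrite -monotone_convergence//.
  - by apply: eq_integral => t _; exact/esym/cvg_lim.
  - by move=> m t _; rewrite lee_fin prodr_ge0.
  - move=> t _ p q pq; rewrite lee_fin; apply: ler_prod => i _.
    by rewrite h0 nd_h.
apply: lime_le.
  apply: ereal_nondecreasing_is_cvgn => p q pq; apply: ge0_le_integral => //.
  - by move=> t _; rewrite lee_fin prodr_ge0.
  - exact: mprod.
  - exact: mprod.
  - move=> t _; rewrite lee_fin; apply: ler_prod => i _.
    by rewrite h0 nd_h.
apply: nearW => m; rewrite /h.
under eq_integral.
  move=> t _; under eq_bigr do rewrite dyadic_setP.
  over.
have l0 k : 0 <= @dyadic_level m k by rewrite /dyadic_level; case: ifP.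
rewrite (@integral_prod_simple _ (fun=> @dyadic_level m)
  (fun i => @dyadic_set (g i) m))//; last first.
  by move=> i k; exact: measurable_dyadic_set.
rewrite lee_fin; apply: ler_prod => i _; apply/andP; split.
  by rewrite sumr_ge0// => k _; rewrite mulr_ge0// fine_ge0.
(* The finite sum of probabilities is read back as the integral of a simple function lying below
   [g i]. *)
rewrite -lee_fin -integral_sum_indic//; last first.
  by move=> k; apply: m_preim; exact: measurable_dyadic_set.
apply: le_trans (gb i); apply: ge0_le_integral => //.
- by move=> t _; rewrite lee_fin sumr_ge0// => k _; rewrite mulr_ge0// indicE.
- apply/measurable_EFinP; apply: measurable_sum => k; apply: measurable_funM => //.
  by apply: measurable_indic; apply: m_preim; exact: measurable_dyadic_set.
- exact/measurable_EFinP/mgw.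
- move=> t _; rewrite lee_fin; apply: le_trans (hg i m (w i t)).
  by rewrite /h dyadic_setP.
Qed.

(** Markov's inequality for exp of the sum: on the event it exceeds [c], the exponential of the
    threshold, while its expectation is at most the exponential of the sum of the [b i]. *)
Lemma chernoff_independent (f : I -> borel_cV R n -> R) (b : I -> R) (u : R) :
  (forall i, measurable_fun setT (f i)) ->
  (forall i, \int[P]_t (expR (f i (w i t)))%:E <= (expR (b i))%:E)%E ->
  (P [set t | (\sum_i b i + u < \sum_i f i (w i t))%R] <= (expR (- u))%:E)%E.
Proof.
move=> mf fb; set A := (X in P X).
have mS : measurable_fun setT (fun t => \sum_i f i (w i t)).
  by apply: measurable_sum => i; exact: (measurableT_comp (mf i) (mw i)).
have mA : measurable A.
  have := measurable_fun_ltr (measurable_cst (\sum_i b i + u)) mS.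
  by move=> /(_ measurableT [set true]); rewrite setTI; apply.
pose c := expR (\sum_i b i + u).
have : (\int[P]_t (c * \1_A t)%:E <= \int[P]_t (\prod_i expR (f i (w i t)))%:E)%E.
  apply: ge0_le_integral => //.
  - by move=> t _; rewrite lee_fin mulr_ge0// ?expR_ge0// indicE.
  - apply/measurable_EFinP; apply: measurable_funM => //.
  - apply/measurable_EFinP; under eq_fun do rewrite -expR_sum.
    exact: measurableT_comp.
  - move=> t _; rewrite lee_fin -expR_sum indicE.
    have [|] := boolP (t \in A); last by rewrite mulr0 expR_ge0.
    by rewrite inE mulr1 ler_expR => /ltW.
have prod_le := integral_prod_le (g := fun i => expR \o f i)
  (fun i => measurableT_comp (@measurable_expR R) (mf i)) (fun i x => expR_ge0 _) fb.
move=> /le_trans /(_ prod_le) h.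
(* The one-term instance computes the integral of [c] times the indicator of [A]. *)
have := integral_sum_indic (I := unit) (c := fun=> c) (A := fun=> A)
  (fun=> expR_ge0 _) (fun=> mA).
under eq_integral do rewrite big_const/= card_unit/= addr0.
rewrite big_const/= card_unit/= addr0 => E.
move: h; rewrite E -expR_sum lee_fin.
rewrite -(fineK (fin_num_measure P _ mA)) lee_fin.
by rewrite /c expRD -mulrA ger_pMr ?expR_gt0// expRN -ler_pdivlMl ?expR_gt0// mulr1.
Qed.

End independence.

(** * Sub-Gaussian vectors *)

Section sub_gaussian_moments.
Context (R : realType) d (T : measurableType d) (P : probability T R).

Lemma sub_gaussian_norm_ge0 (X : T -> R) : (0 <= sub_gaussian_norm P X)%E.
Proof.
apply: ereal_sup_ge; eexists; first by exists 1%N.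
by rewrite mule_ge0 ?Lnorm_ge0// lee_fin invr_ge0 sqrtr_ge0.
Qed.

(** The norm bound at order p = 2k gives (K sqrt(2k))^(2k) = (2 K^2 k)^k. *)
Lemma sub_gaussian_even_moment (X : T -> R) (K : R) (k : nat) : (0 < k)%N ->
  (sub_gaussian_norm P X <= K%:E)%E ->
  (\int[P]_t ((X t ^+ 2) ^+ k)%:E <= ((2 * K ^+ 2 * k%:R) ^+ k)%:E)%E.
Proof.
move=> k0 XK.
have K0 : 0 <= K by rewrite -lee_fin (le_trans (sub_gaussian_norm_ge0 X) XK).
pose p := (2 * k)%N; have p0 : (0 < p)%N by rewrite muln_gt0.
have s0 : 0 < Num.sqrt (p%:R : R) by rewrite sqrtr_gt0 ltr0n.
have NK : ('N[P]_(p%:R%:E)[EFin \o X] <= (K * Num.sqrt p%:R)%:E)%E.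
  rewrite mulrC EFinM -lee_pdivrMl//; apply: le_trans XK.
  by apply: ereal_sup_ubound; exists p.
have -> : (\int[P]_t ((X t ^+ 2) ^+ k)%:E)%E = ('N[P]_(p%:R%:E)[EFin \o X] `^ p%:R)%E.
  rewrite poweR_Lnorm ?pnatr_eq0 -?lt0n//; apply: eq_integral => t _ /=.
  by rewrite powR_mulrn// exprM real_normK ?num_real.
apply: (@le_trans _ _ ((K * Num.sqrt p%:R)%:E `^ p%:R)%E).
  apply: gt0_ler_poweR => //; rewrite in_itv/= ?Lnorm_ge0 ?leey//.
  by rewrite lee_fin mulr_ge0// sqrtr_ge0.
rewrite poweR_EFin powR_mulrn ?mulr_ge0 ?sqrtr_ge0// lee_fin.
by rewrite exprM [(K * _) ^+ 2]exprMn sqr_sqrtr// natrM mulrCA mulrA.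
Qed.

End sub_gaussian_moments.

(** * Quadratic forms and the Euclidean norm *)

Section quadratic_forms.
Context (R : realType) (n : nat).

Lemma dotvE (x z : 'cV[R]_n) : dotv x z = \sum_i x i 0 * z i 0.
Proof. by rewrite /dotv mxE; apply: eq_bigr => i _; rewrite mxE. Qed.

Lemma dotvZr (a : R) (x z : 'cV[R]_n) : dotv x (a *: z) = a * dotv x z.
Proof. by rewrite /dotv -scalemxAr mxE. Qed.

Lemma quad_form_outer (x z : 'cV[R]_n) :
  (z^T *m (x *m x^T) *m z) 0 0 = dotv x z ^+ 2.
Proof.
rewrite mulmxA -mulmxA mxE big_ord1 expr2; congr (_ * _).
by rewrite /dotv -[in LHS](trmxK x) -trmx_mul mxE.
Qed.

Lemma quad_formE (A : 'M[R]_n) (z : 'cV[R]_n) :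
  (z^T *m A *m z) 0 0 = \sum_(p : 'I_n * 'I_n) z p.1 0 * z p.2 0 * A p.1 p.2.
Proof.
rewrite -(pair_bigA _ (fun i k => z i 0 * z k 0 * A i k))/= exchange_big/= mxE.
apply: eq_bigr => k _; rewrite mxE mulr_suml; apply: eq_bigr => i _.
by rewrite mxE; ring.
Qed.

Lemma quad_formZ (A : 'M[R]_n) (a : R) (z : 'cV[R]_n) :
  ((a *: z)^T *m A *m (a *: z)) 0 0 = a ^+ 2 * (z^T *m A *m z) 0 0.
Proof.
by rewrite [(a *: z)^T]linearZ/= -!scalemxAl -scalemxAr !mxE mulrA expr2.
Qed.

Lemma measurable_coord (i : 'I_n) :
  measurable_fun setT (fun v : borel_cV R n => (v : 'cV[R]_n) i 0).
Proof.
apply: (measurability _ (RGenOInfty.measurableE R)) => _ [_ [a ->] <-].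
rewrite setTI; apply: sub_sigma_algebra => /=.
apply: (@open_comp _ _ (fun v : 'cV[R]_n => v i 0)); last exact: interval_open.
by move=> v _; exact: coord_continuous.
Qed.

Lemma measurable_dotv (z : 'cV[R]_n) :
  measurable_fun setT (fun v : borel_cV R n => dotv (v : 'cV[R]_n) z).
Proof.
under eq_fun do rewrite dotvE.
apply: measurable_sum => i; apply: measurable_funM => //.
exact: measurable_coord.
Qed.

Lemma l2norm_delta (i : 'I_n) : l2norm (delta_mx i 0 : 'cV[R]_n) = 1.
Proof.
rewrite /l2norm (bigD1 i)//= big1 => [|k /negbTE ki].
  by rewrite addr0 mxE !eqxx expr1n sqrtr1.
by rewrite mxE ki /= expr0n.
Qed.

Lemma dotv_delta (x : 'cV[R]_n) (i : 'I_n) : dotv x (delta_mx i 0) = x i 0.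
Proof.
rewrite dotvE (bigD1 i)//= big1 => [|k /negbTE ki]; last first.
  by rewrite mxE ki mulr0.
by rewrite addr0 mxE !eqxx mulr1.
Qed.

Lemma l2norm_ge0 (z : 'cV[R]_n) : 0 <= l2norm z.
Proof. exact: sqrtr_ge0. Qed.

Lemma sqr_l2norm (z : 'cV[R]_n) : l2norm z ^+ 2 = \sum_i z i 0 ^+ 2.
Proof. by rewrite sqr_sqrtr// sumr_ge0// => i _; exact: sqr_ge0. Qed.

Lemma l2normZ (a : R) (z : 'cV[R]_n) : l2norm (a *: z) = `|a| * l2norm z.
Proof.
rewrite /l2norm -sqrtr_sqr -sqrtrM ?sqr_ge0// mulr_sumr; congr Num.sqrt.
by apply: eq_bigr => i _; rewrite mxE exprMn.
Qed.

Lemma l2norm_eq0 (z : 'cV[R]_n) : (l2norm z == 0) = (z == 0).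
Proof.
apply/eqP/eqP => [z0|->]; last first.
  by rewrite /l2norm big1 ?sqrtr0// => i _; rewrite mxE expr0n.
have /eqP := sqr_l2norm z; rewrite z0 expr0n eq_sym psumr_eq0 => [/allP h|i _].
  apply/matrixP => i j; rewrite !mxE (ord1 j).
  by have := h i (mem_index_enum i); rewrite sqrf_eq0 => /eqP.
exact: sqr_ge0.
Qed.

Lemma l2norm_unit_scale (v : 'cV[R]_n) : v != 0 ->
  exists2 u, l2norm u = 1 & v = l2norm v *: u.
Proof.
move=> v0; have nv0 : 0 < l2norm v.
  by rewrite lt_neqAle l2norm_ge0 eq_sym l2norm_eq0 v0.
exists ((l2norm v)^-1 *: v).
  by rewrite l2normZ ger0_norm ?invr_ge0 ?ltW// mulVf// gt_eqF.
by rewrite scalerA divff ?gt_eqF// scale1r.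
Qed.

End quadratic_forms.

(** * Second moment matrices as expected quadratic forms *)

Section second_moments.
Context (R : realType) d (T : measurableType d) (P : probability T R).
Context (n : nat) (w : T -> 'cV[R]_n) (K : R).
Hypothesis mw : random_vector w.
Hypothesis wK : (sub_gaussian_vector_norm P w <= K%:E)%E.

Lemma measurable_coord_rv (i : 'I_n) : measurable_fun setT (fun t => w t i 0).
Proof. exact: (measurableT_comp (@measurable_coord R n i) mw). Qed.

Lemma measurable_dotv_rv (z : 'cV[R]_n) :
  measurable_fun setT (fun t => dotv (w t) z).
Proof. exact: (measurableT_comp (@measurable_dotv R n z) mw). Qed.

Lemma sub_gaussian_norm_dotv (z : 'cV[R]_n) : l2norm z = 1 ->
  (sub_gaussian_norm P (fun t => dotv (w t) z) <= K%:E)%E.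
Proof. by move=> z1; apply: le_trans wK; apply: ereal_sup_ubound; exists z. Qed.

(** Basis vectors give finite E[w_i^2], and |w_i w_k| <= w_i^2 + w_k^2 makes every entry integrable.
    Hence [fine] loses nothing and the integral is linear over the entries. *)
Lemma second_momentE (z : 'cV[R]_n) :
  (\int[P]_t (dotv (w t) z ^+ 2)%:E =
   ((z^T *m second_moment P w *m z) 0 0)%:E)%E.
Proof.
have int2 i : P.-integrable setT (EFin \o (fun t => w t i 0 ^+ 2 : R)).
  apply/integrableP; split.
    apply/measurable_EFinP/measurable_funX; exact: measurable_coord_rv.
  have e1 := sub_gaussian_norm_dotv (l2norm_delta R i).
  have := sub_gaussian_even_moment (ltn0Sn 0) e1.
  under eq_integral do rewrite dotv_delta expr1.
  move=> h; apply: le_lt_trans (ltry _).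
  apply: le_trans h; apply: ge0_le_integral => //.
  - apply/measurable_EFinP/measurableT_comp => //.
    apply: measurable_funX; exact: measurable_coord_rv.
  - apply/measurable_EFinP/measurable_funX; exact: measurable_coord_rv.
  - by move=> t _; rewrite lee_fin ger0_norm// sqr_ge0.
have int11 i k : P.-integrable setT (EFin \o (fun t => w t i 0 * w t k 0 : R)).
  apply: (le_integrable _ _ _ (integrableD _ (int2 i) (int2 k))) => //.
    apply/measurable_EFinP/measurable_funM; exact: measurable_coord_rv.
  move=> t _ /=; rewrite lee_fin [leRHS]ger0_norm ?addr_ge0 ?sqr_ge0//.
  rewrite ler_norml; apply/andP; split.
    have := sqr_ge0 (w t i 0 + w t k 0); have := sqr_ge0 (w t i 0).
    have := sqr_ge0 (w t k 0); nra.
  have := sqr_ge0 (w t i 0 - w t k 0); have := sqr_ge0 (w t i 0).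
  have := sqr_ge0 (w t k 0); nra.
have entryE i k :
    (\int[P]_t (w t i 0 * w t k 0)%:E = (second_moment P w i k)%:E)%E.
  rewrite mxE unlock; under [in RHS]eq_integral do rewrite mxE big_ord1 mxE.
  by rewrite fineK//; exact: integrable_fin_num (int11 i k).
under eq_integral do rewrite -quad_form_outer quad_formE -sumEFin.
rewrite integral_sum//; last first.
  move=> p; under eq_fun do rewrite EFinM; apply: integrableZl => //.
  by under eq_fun do rewrite mxE big_ord1 mxE; exact: int11.
rewrite quad_formE -sumEFin; apply: eq_bigr => p _.
under eq_integral do rewrite mxE big_ord1 mxE EFinM.
by rewrite integralZl ?entryE// ; exact: int11.
Qed.

End second_moments.

(** * Two-sided tail of the quadratic form at a fixed vector *)

Section quadratic_tail.
Context (R : realType) d (T : measurableType d) (P : probability T R).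
Context (n N : nat) (w : 'I_N -> T -> 'cV[R]_n) (K : R).
Hypothesis N_gt0 : (0 < N)%N.
Hypothesis mw : forall j, random_vector (w j).
Hypothesis indep : mutually_independent P w.
Hypothesis wK : forall j, (sub_gaussian_vector_norm P (w j) <= K%:E)%E.

Local Notation D := (second_moment_deviation P w).

Lemma quad_form_deviation (t : T) (z : 'cV[R]_n) :
  (z^T *m D t *m z) 0 0 =
  N%:R^-1 * (\sum_j dotv (w j t) z ^+ 2
             - \sum_j (z^T *m second_moment P (w j) *m z) 0 0).
Proof.
have subE (A B : 'M[R]_1) : (A - B) 0 0 = A 0 0 - B 0 0 by rewrite !mxE.
have scaleE a (A : 'M[R]_1) : (a *: A) 0 0 = a * A 0 0 by rewrite mxE.
rewrite /second_moment_deviation mulmxBr mulmxBl -!scalemxAr -!scalemxAl.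
rewrite subE !scaleE mulrBr; congr (_ * _ - _ * _).
  rewrite mulmx_sumr mulmx_suml summxE; apply: eq_bigr => j _.
  exact: quad_form_outer.
by rewrite mulmx_sumr mulmx_suml summxE.
Qed.

Lemma measurable_quad_form_deviation (z : 'cV[R]_n) :
  measurable_fun setT (fun t => (z^T *m D t *m z) 0 0).
Proof.
under eq_fun do rewrite quad_form_deviation.
apply: measurable_funM => //; apply: measurable_funB => //.
apply: measurable_sum => j; apply: measurable_funX; exact: measurable_dotv_rv.
Qed.

(** The right side is maximal at th = eps / 64, with value eps^2 / 32. The cap at 1/64 keeps the
    exponential moments under control; for eps > 1 it leaves eps/16 - 1/32 >= eps/32. *)
Lemma chernoff_exponent_le (eps th : R) : 0 < eps ->
  th = Num.min eps 1 / 64 ->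
  Num.min eps (eps ^+ 2) / 32 <= 4 * eps * th - 128 * th ^+ 2.
Proof.
move=> e0 ->; have [e1|e1] := leP eps 1.
  have -> : Num.min eps (eps ^+ 2) = eps ^+ 2.
    by apply/min_idPr; rewrite expr2 ger_pMl.
  nra.
have -> : Num.min eps (eps ^+ 2) = eps.
  by apply/min_idPl; rewrite expr2 ler_pMl// ltW.
nra.
Qed.

Lemma quad_form_tail_unit (z : 'cV[R]_n) (eps : R) :
  0 < K -> l2norm z = 1 -> 0 < eps ->
  (P [set t | (4 * eps * K ^+ 2 < `|(z^T *m D t *m z) 0 0|)%R] <=
   (2 * expR (- (Num.min eps (eps ^+ 2) / 32 * N%:R)))%:E)%E.
Proof.
move=> K0 z1 e0.
have K20 : 0 < K ^+ 2 by rewrite exprn_gt0.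
have NR0 : 0 < N%:R :> R by rewrite ltr0n.
pose th : R := Num.min eps 1 / 64.
have th0 : 0 < th by rewrite divr_gt0// lt_min e0 ltr01.
have th1 : th <= 64^-1 by rewrite ler_pdivrMr// mulVf// ge_min lexx orbT.
(* This scaling removes K: the k-th moment of l (w_j' z)^2 is at most (2 th k)^k. With a = 2 th, the
   error 32 a^2 is 128 th^2. *)
pose l := th / K ^+ 2; have l0 : 0 < l by rewrite divr_gt0.
pose m j := (z^T *m second_moment P (w j) *m z) 0 0.
pose X j t := l * dotv (w j t) z ^+ 2.
have mX j : measurable_fun setT (X j).
  apply: measurable_funM => //; apply: measurable_funX; exact: measurable_dotv_rv.
have X0 j t : 0 <= X j t by rewrite mulr_ge0 ?sqr_ge0// ltW.
have EX j : (\int[P]_t (X j t)%:E = (l * m j)%:E)%E.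
  rewrite /X; under eq_integral do rewrite EFinM.
  rewrite ge0_integralZl_EFin ?(ltW l0)//.
  - by rewrite (second_momentE (mw j) (wK j))// EFinM.
  - by move=> t _; rewrite lee_fin sqr_ge0.
  - apply/measurable_EFinP/measurable_funX; exact: measurable_dotv_rv.
have EXk j k : (0 < k)%N ->
    (\int[P]_t (X j t ^+ k)%:E <= ((2 * th * k%:R) ^+ k)%:E)%E.
  move=> k0; rewrite /X; under eq_integral do rewrite exprMn EFinM.
  rewrite ge0_integralZl_EFin ?exprn_ge0 ?(ltW l0)//; first last.
  - apply/measurable_EFinP/measurable_funX/measurable_funX.
    exact: measurable_dotv_rv.
  - by move=> t _; rewrite lee_fin exprn_ge0// sqr_ge0.
  have := sub_gaussian_even_moment k0 (sub_gaussian_norm_dotv (wK j) z1).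
  have lk0 : 0 < l ^+ k by rewrite exprn_gt0.
  rewrite -(lee_pmul2l (_ : (l ^+ k)%:E \is a fin_num) lk0)// => /le_trans; apply.
  rewrite -EFinM lee_fin -exprMn /l le_eqVlt; apply/orP; left; apply/eqP.
  by congr (_ ^+ _); field; rewrite gt_eqF.
have a8 : 8 * (2 * th) <= 1 by move: th1; lra.
have up j : (\int[P]_t (expR (X j t))%:E <= (expR (l * m j + 128 * th ^+ 2))%:E)%E.
  have := mgf_le (mX j) (X0 j)
    (mulr_ge0 (ler0n _ _) (ltW th0)) a8 (EX j) (fun k k2 => EXk j k (ltnW k2)).
  by rewrite exprMn mulrA -natrX -natrM.
have dn j : (\int[P]_t (expR (- X j t))%:E <= (expR (- (l * m j) + 128 * th ^+ 2))%:E)%E.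
  have := mgfN_le (mX j) (X0 j) (EX j) (EXk j 2%N isT).
  by rewrite exprMn mulrA -natrX -natrM.
(* Since l K^2 = th, the scaled deviation exceeds 4 eps th N; the N second-order errors are
   deducted. *)
pose u : R := N%:R * (4 * eps * th - 128 * th ^+ 2).
have mdot : measurable_fun setT (fun v : borel_cV R n => l * dotv (v : 'cV[R]_n) z ^+ 2).
  apply: measurable_funM => //; apply: measurable_funX; exact: measurable_dotv.
have Pup := chernoff_independent mw indep (f :=
  fun _ v => l * dotv (v : 'cV[R]_n) z ^+ 2) u
  (fun _ => mdot) up.
have Pdn := chernoff_independent mw indep (f :=
  fun _ v => - (l * dotv (v : 'cV[R]_n) z ^+ 2)) u
  (fun _ => measurable_funN mdot) dn.
set A := (X in P X); set B1 := (X in P X) in Pup; set B2 := (X in P X) in Pdn.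
have mlt (f : T -> R) (c : R) : measurable_fun setT f -> measurable [set t | c < f t].
  move=> mf; have := measurable_fun_ltr (measurable_cst c) mf.
  by move=> /(_ measurableT [set true]); rewrite setTI; apply.
have mA : measurable A.
  by apply: mlt; apply: measurableT_comp => //; exact: measurable_quad_form_deviation.
have mB1 : measurable B1 by apply: mlt; apply: measurable_sum => j; exact: mX.
have mB2 : measurable B2.
  by apply: mlt; apply: measurable_sum => j; apply: measurable_funN; exact: mX.
have AB : A `<=` B1 `|` B2.
  move=> t; rewrite /A/= quad_form_deviation => h.
  have sumc : \sum_(j < N) 128 * th ^+ 2 = N%:R * (128 * th ^+ 2).
    by rewrite sumr_const card_ord -[LHS]mulr_natl.
  have key : N%:R * (4 * eps * th) <
      `|\sum_j l * dotv (w j t) z ^+ 2 - \sum_j l * m j|.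
    rewrite -!mulr_sumr -mulrBr normrM (gtr0_norm l0).
    have -> : N%:R * (4 * eps * th) = l * (N%:R * (4 * eps * K ^+ 2)).
      by rewrite /l; field; rewrite gt_eqF.
    rewrite ltr_pM2l// -ltr_pdivlMl//.
    by move: h; rewrite normrM gtr0_norm ?invr_gt0.
  move: key; rewrite lter_normr => /orP[key|key]; [left|right].
    by rewrite /B1/= big_split/= sumc /u; move: key; lra.
  by rewrite /B2/= !sumrN big_split/= sumc !sumrN /u; move: key; lra.
apply: (@le_trans _ _ (P B1 + P B2)%E).
  apply: (le_trans (le_measure P _ _ AB)); rewrite ?inE//; first exact: measurableU.
  exact: measureU2.
apply: (@le_trans _ _ ((expR (- u))%:E + (expR (- u))%:E)%E); first exact: leeD.
rewrite -EFinD lee_fin mulr2n mulrDl mul1r.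
suff : expR (- u) <= expR (- (Num.min eps (eps ^+ 2) / 32 * N%:R)) by lra.
rewrite ler_expR lerN2 /u mulrC ler_pM2l//.
exact: chernoff_exponent_le.
Qed.

Lemma quad_form_tail (z : 'cV[R]_n) (eps : R) : 0 < K -> 0 < eps ->
  (P [set t | (4 * eps * K ^+ 2 * l2norm z ^+ 2 < `|(z^T *m D t *m z) 0 0|)%R] <=
   (2 * expR (- (Num.min eps (eps ^+ 2) / 32 * N%:R)))%:E)%E.
Proof.
move=> K0 e0; have [->|z0] := eqVneq z 0.
  rewrite [X in P X](_ : _ = set0) ?measure0 ?lee_fin ?mulr_ge0 ?expR_ge0//.
  apply/seteqP; split => // t /=; rewrite mulmx0 mxE normr0.
  by rewrite (eqP (_ : l2norm (0 : 'cV[R]_n) == 0)) ?l2norm_eq0// expr0n mulr0 ltxx.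
have [v v1 zE] := l2norm_unit_scale z0.
have s0 : 0 < l2norm z by rewrite lt_neqAle l2norm_ge0 eq_sym l2norm_eq0 z0.
apply: le_trans (quad_form_tail_unit K0 v1 e0).
rewrite le_eqVlt; apply/orP; left; apply/eqP; congr (P _).
have qE t : (z^T *m D t *m z) 0 0 = l2norm z ^+ 2 * (v^T *m D t *m v) 0 0.
  by rewrite {1 2}zE quad_formZ.
apply/seteqP; split => t /=; rewrite qE normrM ger0_norm ?sqr_ge0//;
  by rewrite [l2norm z ^+ 2 * _]mulrC ltr_pM2r// exprn_gt0.
Qed.

End quadratic_tail.

(** * Operator norm and discretization of the sphere *)

Section operator_norm.
Context (R : realType) (n : nat).
Implicit Types (x y z v : 'cV[R]_n) (A : 'M[R]_n).

Lemma dotvC x y : dotv x y = dotv y x.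
Proof. by rewrite !dotvE; apply: eq_bigr => i _; rewrite mulrC. Qed.

Lemma dotvv x : dotv x x = l2norm x ^+ 2.
Proof. by rewrite dotvE sqr_l2norm; apply: eq_bigr => i _; rewrite expr2. Qed.

Lemma dotvDl x y z : dotv (x + y) z = dotv x z + dotv y z.
Proof. by rewrite /dotv linearD/= mulmxDl mxE. Qed.

Lemma dotvDr x y z : dotv z (x + y) = dotv z x + dotv z y.
Proof. by rewrite dotvC dotvDl !(dotvC z). Qed.

Lemma dotvZl (a : R) x z : dotv (a *: x) z = a * dotv x z.
Proof. by rewrite dotvC dotvZr dotvC. Qed.

Lemma quad_form_dotv A z : (z^T *m A *m z) 0 0 = dotv z (A *m z).
Proof. by rewrite /dotv mulmxA. Qed.

(** For unit vectors, |u + v|^2 and |u - v|^2 are 2 + 2 u'v and 2 - 2 u'v, both nonnegative; scaling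
    gives the rest. *)
Lemma cauchy_schwarz x y : `|dotv x y| <= l2norm x * l2norm y.
Proof.
have unit_le u v : l2norm u = 1 -> l2norm v = 1 -> `|dotv u v| <= 1.
  move=> u1 v1; rewrite ler_norml; apply/andP; split.
    have := sqr_ge0 (l2norm (u + v)).
    rewrite -dotvv !(dotvDl, dotvDr) !dotvv u1 v1 (dotvC v u); lra.
  have := sqr_ge0 (l2norm (u + (-1) *: v)).
  rewrite -dotvv !(dotvDl, dotvDr, dotvZl, dotvZr) !dotvv u1 v1 (dotvC v u); lra.
have [->|x0] := eqVneq x 0.
  by rewrite /dotv trmx0 mul0mx mxE normr0 mulr_ge0// l2norm_ge0.
have [->|y0] := eqVneq y 0.
  by rewrite /dotv mulmx0 mxE normr0 mulr_ge0// l2norm_ge0.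
have [u u1 xE] := l2norm_unit_scale x0; have [v v1 yE] := l2norm_unit_scale y0.
rewrite {1}xE {1}yE dotvZl dotvZr !normrM !(ger0_norm (l2norm_ge0 _)) mulrA.
by rewrite ler_piMr ?mulr_ge0 ?l2norm_ge0 ?unit_le.
Qed.

Hypothesis n_gt0 : (0 < n)%N.

Lemma l2norm_le_opnorm A z : l2norm (A *m z) <= opnorm A * l2norm z.
Proof.
have [->|/l2norm_unit_scale [u u1 ->]] := eqVneq z 0.
  by rewrite mulmx0 (eqP (_ : l2norm (0 : 'cV[R]_n) == 0)) ?l2norm_eq0// mulr0.
rewrite -scalemxAr !l2normZ u1 mulr1 mulrC ler_wpM2r//.
apply: sup_ubound; first exact: (has_sup_opnorm A n_gt0).2.
by exists u.
Qed.

Lemma opnorm_ge0 A : 0 <= opnorm A.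
Proof.
have := l2norm_le_opnorm A (delta_mx (Ordinal n_gt0) 0).
by rewrite l2norm_delta mulr1; exact/le_trans/l2norm_ge0.
Qed.

Lemma opnorm_le A (a : R) :
  (forall z, l2norm z = 1 -> l2norm (A *m z) <= a) -> opnorm A <= a.
Proof.
move=> h; apply: ge_sup; first exact: (has_sup_opnorm A n_gt0).1.
by move=> _ [z z1 <-]; exact: h.
Qed.

(** With y the direction of A z, |A z| = y' A z. By symmetry, four times this is the difference of
    the quadratic form at y + z and y - z, at most M (|y + z|^2 + |y - z|^2) = 4 M. *)
Lemma opnorm_le_quad_form A (M : R) : A^T = A ->
  (forall z, l2norm z = 1 -> `|(z^T *m A *m z) 0 0| <= M) -> opnorm A <= M.
Proof.
move=> symA hM.
have M0 : 0 <= M.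
  exact: le_trans (hM _ (l2norm_delta R (Ordinal n_gt0))).
have quad_le v : `|dotv v (A *m v)| <= M * l2norm v ^+ 2.
  have [->|/l2norm_unit_scale [u u1 ->]] := eqVneq v 0.
    by rewrite /dotv mulmx0 mulmx0 mxE normr0 mulr_ge0// sqr_ge0.
  rewrite -scalemxAr dotvZl dotvZr mulrA -expr2 normrM.
  rewrite l2normZ u1 mulr1 (ger0_norm (l2norm_ge0 v)) (ger0_norm (sqr_ge0 _)).
  by rewrite mulrC ler_wpM2r ?sqr_ge0// -quad_form_dotv hM.
apply: opnorm_le => z z1.
have [->|/l2norm_unit_scale [y y1 Az]] := eqVneq (A *m z) 0.
  by rewrite (eqP (_ : l2norm (0 : 'cV[R]_n) == 0)) ?l2norm_eq0.
set s := l2norm (A *m z) in Az *.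
have sE : s = dotv y (A *m z) by rewrite Az dotvZr dotvv y1 expr1n mulr1.
have symE : dotv z (A *m y) = dotv y (A *m z).
  by rewrite dotvC {1}/dotv trmx_mul symA -mulmxA.
(* polarization *)
have := quad_le (y + z); have := quad_le (y + (-1) *: z).
rewrite -!dotvv !mulmxDr -!scalemxAr.
rewrite !(dotvDl, dotvDr, dotvZl, dotvZr) !dotvv y1 z1 symE (dotvC z y) -sE.
by rewrite !ler_norml => /andP[? ?] /andP[? ?]; lra.
Qed.

End operator_norm.

(** * A finite net obtained by rounding coordinates *)

Section grid_net.
Context (R : realType) (n : nat).
Hypothesis n_gt0 : (0 < n)%N.

(** Sign and magnitude per coordinate, so that rounding towards 0 truncates the magnitude. Zero has
    two codes, which the count tolerates. *)
Definition grid_index := {ffun 'I_n -> bool * 'I_(16 * n).+1}.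

Definition grid_point (phi : grid_index) : 'cV[R]_n :=
  \col_i ((-1) ^+ (phi i).1 * (phi i).2%:R / (4 * Num.sqrt n%:R)).

(** An l1 constraint, since it can be counted with product weights. It admits points outside the
    unit ball; [grid_net_approx] selects points inside. *)
Definition grid_net : {set grid_index} :=
  [set phi : grid_index | (\sum_i (phi i).2 <= 16 * n)%N].

(** On the net 1 <= 2^(16n) times the product of the 2^(-k_i). Summed over all indices, the weight
    factors into n sums, each at most 4 (two signs, a geometric series), whence 2^(16n) 4^n. *)
Lemma card_grid_net : #|grid_net|%:R <= 2 ^+ (18 * n) :> R.
Proof.
have geom m : \sum_(k < m) (2^-1 : R) ^+ k <= 2.
  suff : \sum_(k < m) (2^-1 : R) ^+ k <= 2 - 2 * 2^-1 ^+ m.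
    have : 0 <= (2^-1 : R) ^+ m by rewrite exprn_ge0. lra.
  elim: m => [|m IH]; first by rewrite big_ord0 expr0 mulr1 subrr.
  rewrite big_ord_recr/= exprS; move: IH; lra.
pose wt (p : bool * 'I_(16 * n).+1) : R := 2^-1 ^+ p.2.
have wt0 p : 0 <= wt p by rewrite exprn_ge0.
have -> : #|grid_net|%:R = \sum_(phi in grid_net) (1 : R).
  by rewrite sumr_const.
apply: (@le_trans _ _ (\sum_(phi : grid_index) 2 ^+ (16 * n) * \prod_i wt (phi i))).
  rewrite big_mkcond/=; apply: ler_sum => phi _; case: ifPn => [|_].
    rewrite inE => le16; rewrite /wt -expr_sum exprVn -ler_pdivrMl ?exprn_gt0//.
    rewrite mulr1 lef_pV2 ?posrE ?exprn_gt0// ler_weXn2l//; lra.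
  by rewrite mulr_ge0 ?exprn_ge0// prodr_ge0.
rewrite -mulr_sumr -(bigA_distr_bigA (fun=> wt))/= prodr_const card_ord.
rewrite (_ : 18 * n = 16 * n + 2 * n)%N; last by rewrite -mulnDl.
rewrite exprD ler_wpM2l ?exprn_ge0// exprM lerXn2r ?nnegrE ?sumr_ge0 ?exprn_ge0//.
rewrite -(pair_bigA _ (fun (b : bool) (k : 'I_(16 * n).+1) => wt (b, k)))/=.
rewrite big_bool /wt/=; have := geom (16 * n).+1; lra.
Qed.

(* Round the coordinates of z towards 0, so that the net stays in the unit ball. *)
Lemma grid_net_approx (z : 'cV[R]_n) : l2norm z = 1 ->
  exists phi, [/\ phi \in grid_net, l2norm (grid_point phi) <= 1 &
                  l2norm (z - grid_point phi) <= 4^-1].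
Proof.
move=> z1.
have sumz : \sum_i z i 0 ^+ 2 = 1 by rewrite -sqr_l2norm z1 expr1n.
pose h : R := 4 * Num.sqrt n%:R.
have h0 : 0 < h by rewrite mulr_gt0// sqrtr_gt0 ltr0n.
have h2 : h ^+ 2 = 16 * n%:R by rewrite exprMn sqr_sqrtr// -natrX.
pose k i := Num.truncn (`|z i 0| * h).
have zh0 i : 0 <= `|z i 0| * h by rewrite mulr_ge0// ltW.
have k_le i : (k i)%:R <= `|z i 0| * h by rewrite truncn_le.
have k_gt i : `|z i 0| * h < (k i)%:R + 1 by rewrite natr1 truncnS_gt.
have sumk2 : \sum_i (k i)%:R ^+ 2 <= 16 * n%:R :> R.
  rewrite -h2 (_ : h ^+ 2 = \sum_i z i 0 ^+ 2 * h ^+ 2); last first.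
    by rewrite -mulr_suml sumz mul1r.
  apply: ler_sum => i _.
  by rewrite -[z i 0 ^+ 2]real_normK ?num_real// -exprMn lerXn2r ?nnegrE.
(* Integrality turns the l2 bound into the l1 bound, as k <= k^2. *)
have sumk : (\sum_i k i <= 16 * n)%N.
  rewrite -(ler_nat R) natrM (le_trans _ sumk2)// natr_sum.
  apply: ler_sum => i _; rewrite -natrX ler_nat.
  by case: (k i) => // m; rewrite expnS expn1 leq_pmull.
have k16 i : (k i < (16 * n).+1)%N.
  by rewrite ltnS (leq_trans _ sumk)// (bigD1 i)//= leq_addr.
pose phi : grid_index := [ffun i => (z i 0 < 0, Ordinal (k16 i))].
have sgz i : z i 0 = (-1) ^+ (z i 0 < 0)%R * `|z i 0|.
  by rewrite -realEsign ?num_real.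
have gE i : grid_point phi i 0 = (-1) ^+ (z i 0 < 0)%R * ((k i)%:R / h).
  by rewrite mxE ffunE/= mulrA.
have norm_le (x : 'cV[R]_n) (b : R) :
    0 <= b -> \sum_i x i 0 ^+ 2 <= b ^+ 2 -> l2norm x <= b.
  by move=> b0 xb; rewrite -(ler_sqr (l2norm_ge0 x) b0) sqr_l2norm.
exists phi; split.
- by rewrite inE; under eq_bigr do rewrite ffunE.
- apply: norm_le => //; rewrite expr1n -sumz; apply: ler_sum => i _.
  rewrite gE exprMn -exprM mulnC exprM sqrrN expr1n expr1n mul1r.
  rewrite -[leRHS]real_normK ?num_real// lerXn2r ?nnegrE ?divr_ge0 ?(ltW h0)//.
  by rewrite ler_pdivrMr.
- apply: norm_le => //.
  (* Each coordinate moves by at most 1/h, and n / h^2 = 1/16. *)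
  apply: (@le_trans _ _ (\sum_(i < n) (h ^+ 2)^-1)); last first.
    rewrite sumr_const card_ord -[leLHS]mulr_natl h2.
    rewrite invfM mulrCA divff ?mulr1 ?pnatr_eq0 -?lt0n//; lra.
  apply: ler_sum => i _.
  have -> : (z - grid_point phi) i 0 = (-1) ^+ (z i 0 < 0)%R * (`|z i 0| - (k i)%:R / h).
    by rewrite mulrBr -sgz -gE !mxE.
  rewrite exprMn -exprM mulnC exprM sqrrN expr1n expr1n mul1r -exprVn.
  have d0 : 0 <= `|z i 0| - (k i)%:R / h by rewrite subr_ge0 ler_pdivrMr.
  rewrite lerXn2r ?nnegrE ?invr_ge0 ?(ltW h0)//.
  rewrite lerBlDr (_ : h^-1 + _ = ((k i)%:R + 1) / h).
    by rewrite ler_pdivlMr// ltW.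
  by rewrite mulrDl mul1r addrC.
Qed.

(** For g near z, z'Az = g'Ag + (z - g)'Az + g'A(z - g). Both cross terms are at most a quarter of
    the norm because |g| <= 1, so the norm is at most [tau] plus half of itself. *)
Lemma opnorm_le_grid_net (A : 'M[R]_n) (tau : R) : A^T = A -> 0 <= tau ->
  (forall phi, phi \in grid_net ->
     `|((grid_point phi)^T *m A *m grid_point phi) 0 0|
       <= tau * l2norm (grid_point phi) ^+ 2) ->
  opnorm A <= 2 * tau.
Proof.
move=> symA tau0 htau.
suff : opnorm A <= tau + opnorm A / 2 by lra.
apply: opnorm_le_quad_form => // z z1.
have [phi [phiS g1 zg]] := grid_net_approx z1.
set g := grid_point phi in g1 zg.
have gtau := htau phi phiS; rewrite -/g in gtau.
have M0 := opnorm_ge0 n_gt0 A.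
have bilin (x y : 'cV[R]_n) : `|dotv x (A *m y)| <= l2norm x * (opnorm A * l2norm y).
  apply: (le_trans (cauchy_schwarz _ _)).
  by rewrite ler_wpM2l ?l2norm_ge0// l2norm_le_opnorm.
have -> : (z^T *m A *m z) 0 0 =
    (g^T *m A *m g) 0 0 + (dotv (z - g) (A *m z) + dotv g (A *m (z - g))).
  rewrite !quad_form_dotv mulmxBr -[in RHS](scaleN1r g).
  rewrite -[in RHS](scaleN1r (A *m g)).
  by rewrite !(dotvDl, dotvDr, dotvZl, dotvZr); lra.
have g2 : tau * l2norm g ^+ 2 <= tau.
  by rewrite ler_piMr// exprn_ile1// l2norm_ge0.
have b1 := bilin (z - g) z; have b2 := bilin g (z - g).
rewrite z1 mulr1 in b1.
have c1 : l2norm (z - g) * opnorm A <= 4^-1 * opnorm A by rewrite ler_wpM2r.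
have c2 : l2norm g * (opnorm A * l2norm (z - g)) <= 1 * (opnorm A * 4^-1).
  apply: ler_pM => //; rewrite ?mulr_ge0 ?l2norm_ge0//.
  by rewrite ler_wpM2l.
apply: (le_trans (ler_normD _ _)).
have := ler_normD (dotv (z - g) (A *m z)) (dotv g (A *m (z - g))).
lra.
Qed.

End grid_net.

(** * Measurability of operator norm events *)

Section opnorm_measurable.
Context (R : realType) (n : nat).
Hypothesis n_gt0 : (0 < n)%N.

(** Rational vectors are dense but rarely of unit length, hence the homogeneous form. Squared norms
    are polynomial in the coordinates, so the inequality passes to limits directly. *)
Lemma opnorm_le_rational (A : 'M[R]_n) (a : R) : 0 <= a ->
  (opnorm A <= a) <->
  (forall q : 'cV[rat]_n,
     l2norm (A *m map_mx ratr q) ^+ 2 <= a ^+ 2 * l2norm (map_mx ratr q : 'cV[R]_n) ^+ 2).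
Proof.
move=> a0; split => [Aa q|Aq].
  rewrite -exprMn lerXn2r ?nnegrE ?mulr_ge0 ?l2norm_ge0//.
  by apply: (le_trans (l2norm_le_opnorm n_gt0 A _)); rewrite ler_wpM2r ?l2norm_ge0.
apply: opnorm_le => // z z1.
have rat_cvg (x : R) : exists q : nat -> rat, ratr (q m) @[m --> \oo] --> x.
  have /choice[q qP] : forall m : nat, exists q : rat, `|x - ratr q| <= m.+1%:R^-1.
    move=> m; have lt_itv : x - m.+1%:R^-1 < x + m.+1%:R^-1.
      by rewrite ltrD2l gtrN// invr_gt0.
    have [q] := rat_in_itvoo lt_itv; rewrite in_itv/= => /andP[? ?].
    by exists q; rewrite ler_distlC !ltW.
  exists q; apply/cvgrPdist_le => /= e e0; near=> m.
  apply: (le_trans (qP m)); apply/ltW; near: m.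
  exact: (near_infty_natSinv_lt (PosNum e0)).
have /choice[q qz] : forall i, exists q : nat -> rat, ratr (q m) @[m --> \oo] --> z i 0.
  by move=> i; exact: rat_cvg.
pose Q m : 'cV[rat]_n := \col_i q i m.
have sqr_norm_cvg p (B : 'M[R]_(p, n)) :
    l2norm (B *m map_mx ratr (Q m)) ^+ 2 @[m --> \oo] --> l2norm (B *m z) ^+ 2.
  rewrite sqr_l2norm; under eq_fun do rewrite sqr_l2norm.
  apply: cvg_big => [|i _]; first exact: add_continuous.
  have Bcvg : (B *m map_mx ratr (Q m)) i 0 @[m --> \oo] --> (B *m z) i 0.
    rewrite mxE; under eq_fun do rewrite mxE.
    apply: cvg_big => [|k _]; first exact: add_continuous.
    apply: cvgM; first exact: cvg_cst.
    by under eq_fun do rewrite !mxE; exact: qz.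
  under eq_fun do rewrite expr2; rewrite expr2; exact: cvgM.
have Acvg := sqr_norm_cvg _ A.
have Icvg := sqr_norm_cvg _ 1%:M; rewrite mul1mx in Icvg.
rewrite -(ler_sqr (l2norm_ge0 _) a0).
have -> : a ^+ 2 = a ^+ 2 * l2norm z ^+ 2 by rewrite z1 expr1n mulr1.
apply: (ler_cvg_to Acvg (cvgM (cvg_cst (a ^+ 2)) Icvg)).
by apply: nearW => m /=; rewrite mul1mx.
Unshelve. all: by end_near. Qed.

Lemma measurable_opnorm_le d (T : measurableType d) (A : T -> 'M[R]_n) (a : R) :
  (forall i k, measurable_fun setT (fun t => A t i k)) ->
  measurable [set t | opnorm (A t) <= a].
Proof.
move=> mA; have [a0|a0] := leP 0 a; last first.
  rewrite [X in measurable X](_ : _ = set0)//; apply/seteqP; split => // t /=.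
  by move=> /(le_trans (opnorm_ge0 n_gt0 _)); rewrite leNgt a0.
pose S (q : 'cV[rat]_n) := [set t | l2norm (A t *m map_mx ratr q) ^+ 2
    <= a ^+ 2 * l2norm (map_mx ratr q : 'cV[R]_n) ^+ 2].
have mS q : measurable (S q).
  have mf : measurable_fun setT (fun t => l2norm (A t *m map_mx ratr q) ^+ 2).
    under eq_fun do rewrite sqr_l2norm.
    apply: measurable_sum => i; apply: measurable_funX.
    under eq_fun do rewrite mxE.
    by apply: measurable_sum => k; exact: measurable_funM.
  have := measurable_fun_ler mf
    (measurable_cst (a ^+ 2 * l2norm (map_mx ratr q : 'cV[R]_n) ^+ 2)).
  by move=> /(_ measurableT [set true]); rewrite setTI; apply.
(* Rational vectors are enumerated by their codes; an integer that codes no vector contributes the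
   whole space. *)
rewrite [X in measurable X](_ : _ =
    \bigcap_(m : nat) if unpickle m is Some q then S q else setT); last first.
  apply/seteqP; split => t /=; rewrite (opnorm_le_rational _ a0).
    by move=> h m _; case: unpickle => //= q; exact: h.
  by move=> h q; have := h (pickle q) I; rewrite pickleK.
by apply: bigcap_measurable => // m _; case: unpickle.
Qed.

End opnorm_measurable.

(** * Deviation bounds *)

Section probability_bounds.
Context (R : realType) d (T : measurableType d) (P : probability T R).

Lemma probability_bigcup_seq_le (I : choiceType) (s : seq I) (B : I -> set T) (b : R) :
  (forall i, measurable (B i)) -> (forall i, (P (B i) <= b%:E)%E) ->
  (P (\bigcup_(i in [set` s]) B i) <= ((size s)%:R * b)%:E)%E.
Proof.
move=> mB PB; rewrite bigcup_seq; elim: s => [|i s IH].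
  by rewrite big_nil measure0 mul0r.
rewrite big_cons /= -natr1 mulrDl mul1r addrC EFinD.
apply: (le_trans (measureU2 _ _ _)) => //; first exact: bigsetU_measurable.
exact: leeD (PB i) IH.
Qed.

Lemma probability_ge_compl (G B : set T) (b : R) :
  measurable G -> measurable B -> ~` G `<=` B -> (P B <= b%:E)%E ->
  ((1 - b)%:E <= P G)%E.
Proof.
move=> mG mB GB Pb.
have PG : (P (~` G) <= b%:E)%E.
  by apply: le_trans Pb; apply: le_measure; rewrite ?inE//; exact: measurableC.
move: PG; rewrite probability_setC// -(fineK (fin_num_measure P _ mG)).
by rewrite -EFinB !lee_fin; lra.
Qed.

(** For a > 0 the events at K = 1/(m+1) decrease to the event X <= 0, and continuity from above
    keeps the bound [b], which does not involve K. *)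
Lemma probability_le0_limit (X : T -> R) (a : R) (b : \bar R) :
  (forall c, measurable [set t | X t <= c]) ->
  (forall K : R, 0 < K -> (b <= P [set t | (X t <= a * K ^+ 2)%R])%E) ->
  (b <= P [set t | (X t <= 0)%R])%E.
Proof.
move=> mX bP; have [a0|a0] := leP a 0.
  apply: (le_trans (bP 1 ltr01)); apply: le_measure; rewrite ?inE//.
  by move=> t /= /le_trans; apply; rewrite expr1n mulr1.
pose K m : R := m.+1%:R^-1.
have K0 m : 0 < K m by rewrite invr_gt0.
pose F m := [set t | X t <= a * K m ^+ 2].
have KC : a * K m ^+ 2 @[m --> \oo] --> 0.
  have K_cvg : K m @[m --> \oo] --> 0.
    apply/cvgrPdist_lt => /= e e0; near=> m; rewrite sub0r normrN gtr0_norm//.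
    by near: m; exact: (near_infty_natSinv_lt (PosNum e0)).
  rewrite -(mulr0 a); apply: cvgM; first exact: cvg_cst.
  by under eq_fun do rewrite expr2; rewrite -(mulr0 0); exact: cvgM.
have FE : \bigcap_m F m = [set t | X t <= 0].
  apply/seteqP; split => t /=.
    move=> h; apply: (ler_cvg_to (cvg_cst (X t)) KC).
    by apply: nearW => m; exact: h.
  by move=> X0 m _; apply: (le_trans X0); rewrite mulr_ge0 ?sqr_ge0// ltW.
have mF m : measurable (F m) by exact: mX.
have ndF : {homo F : m p / (m <= p)%N >-> (p <= m)%O}.
  move=> m p mp; apply/subsetPset => t /= /le_trans; apply.
  rewrite ler_pM2l// lerXn2r ?nnegrE ?(ltW (K0 _))//.
  by rewrite lef_pV2 ?posrE// ler_nat.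
have cvgF : (P \o F) m @[m --> \oo] --> P (\bigcap_m F m).
  apply: nonincreasing_cvg_mu => //; last by rewrite FE.
  by rewrite ltey_eq fin_num_measure.
rewrite -FE -(cvg_lim _ cvgF)//; apply: lime_ge.
  by apply/cvg_ex; eexists; exact: cvgF.
by apply: nearW => m; exact: bP.
Unshelve. all: by end_near. Qed.

End probability_bounds.

Section deviation_bounds.
Context (R : realType) d (T : measurableType d) (P : probability T R).
Context (n N : nat) (w : 'I_N -> T -> 'cV[R]_n).
Hypotheses (n_gt0 : (0 < n)%N) (N_gt0 : (0 < N)%N).
Hypothesis mw : forall j, random_vector (w j).
Hypothesis indep : mutually_independent P w.

Local Notation D := (second_moment_deviation P w).

Lemma second_moment_deviation_sym t : (D t)^T = D t.
Proof.
apply/matrixP => i k; rewrite mxE /second_moment_deviation.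
have symS j : second_moment P (w j) k i = second_moment P (w j) i k.
  rewrite !mxE; congr (fine _); congr expectation; apply/funext => s.
  by rewrite !mxE !big_ord1 !mxE mulrC.
rewrite !(mxE, summxE); congr (_ * _ - _ * _); apply: eq_bigr => j _ //.
by rewrite !mxE !big_ord1 !mxE mulrC.
Qed.

Lemma measurable_deviation_entry i k : measurable_fun setT (fun t => D t i k).
Proof.
have entryE t : D t i k = N%:R^-1 * \sum_j w j t i 0 * w j t k 0
    - N%:R^-1 * \sum_j second_moment P (w j) i k.
  rewrite /second_moment_deviation !(mxE, summxE).
  by congr (_ * _ - _); apply: eq_bigr => j _; rewrite !mxE big_ord1 !mxE.
under eq_fun do rewrite entryE.
apply: measurable_funB => //; apply: measurable_funM => //.
by apply: measurable_sum => j; apply: measurable_funM; exact: measurable_coord_rv.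
Qed.

Lemma measurable_quad_form_le (z : 'cV[R]_n) (a : R) :
  measurable [set t | `|(z^T *m D t *m z) 0 0| <= a].
Proof.
have mf : measurable_fun setT (fun t => `|(z^T *m D t *m z) 0 0|).
  by apply: measurableT_comp => //; exact: measurable_quad_form_deviation.
have := measurable_fun_ler mf (measurable_cst a).
by move=> /(_ measurableT [set true]); rewrite setTI; apply.
Qed.

Lemma measurable_quad_form_gt (z : 'cV[R]_n) (a : R) :
  measurable [set t | a < `|(z^T *m D t *m z) 0 0|].
Proof.
rewrite [X in measurable X](_ : _ = ~` [set t | `|(z^T *m D t *m z) 0 0| <= a]).
  by apply: measurableC; exact: measurable_quad_form_le.
by apply/seteqP; split => t /=; [move=> + /le_lt_trans h => /h; rewrite ltxx
  | move=> /negP; rewrite -ltNge].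
Qed.

(** Write m for the minimum at [eps]; halving [eps] leaves at least m/4, hence the exponent m N /
    128. The net costs at most 9 n log 9, since 2^18 = 4^9 <= 9^9. The excess 8 n log 9 fits into m
    N (1/128 - 1/1280) = 9 m N / 1280. *)
Lemma expR_union_bound (eps : R) : 0 < eps ->
  n%:R * ln 9 <= 1280^-1 * Num.min eps (eps ^+ 2) * N%:R ->
  2 ^+ (18 * n) * (2 * expR (- (Num.min (eps / 2) ((eps / 2) ^+ 2) / 32 * N%:R)))
    <= 2 * expR (n%:R * ln 9 - 1280^-1 * Num.min eps (eps ^+ 2) * N%:R).
Proof.
move=> e0; set m := Num.min eps _ => hn.
have m0 : 0 < m by rewrite lt_min e0 exprn_gt0.
have mq : m / 4 <= Num.min (eps / 2) ((eps / 2) ^+ 2).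
  rewrite le_min; apply/andP; split.
    have : m <= eps by rewrite ge_min lexx.
    by lra.
  have : m <= eps ^+ 2 by rewrite ge_min lexx orbT.
  by rewrite exprMn; lra.
have N0 : 0 <= N%:R :> R by [].
have mN : m / 4 * N%:R <= Num.min (eps / 2) ((eps / 2) ^+ 2) * N%:R.
  by rewrite ler_wpM2r.
have n9 : 0 <= n%:R * ln 9 :> R by rewrite mulr_ge0// ln_ge0// ler1n.
have two : 2 ^+ (18 * n) <= expR (9 * (n%:R * ln 9)) :> R.
  have -> : 9 * (n%:R * ln 9) = ln 9 * (9 * n)%:R :> R by rewrite natrM; ring.
  rewrite expRM_natr lnK ?posrE// -[(18 * n)%N]/((2 * 9) * n)%N -mulnA exprM.
  by rewrite lerXn2r ?nnegrE//; lra.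
rewrite mulrCA ler_pM2l//.
apply: (le_trans (ler_wpM2r (expR_ge0 _) two)).
by rewrite -expRD ler_expR; lra.
Qed.

Lemma deviation_bounds_pos (K eps : R) : 0 < K -> 0 < eps ->
  (forall j, sub_gaussian_vector_norm P (w j) <= K%:E)%E ->
  (forall z : 'cV[R]_n,
    ((1 - 2 * expR (- 1280^-1 * Num.min eps (eps ^+ 2) * N%:R))%:E <=
     P [set t | (`| (z^T *m D t *m z) 0 0 |
                 <= 4 * eps * K ^+ 2 * l2norm z ^+ 2)%R])%E) /\
  ((1 - 2 * expR (n%:R * ln 9 - 1280^-1 * Num.min eps (eps ^+ 2) * N%:R))%:E <=
   P [set t | (opnorm (D t) <= 4 * eps * K ^+ 2)%R])%E.
Proof.
move=> K0 e0 wK.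
have m0 : 0 < Num.min eps (eps ^+ 2) by rewrite lt_min e0 exprn_gt0.
split => [z|].
  apply: probability_ge_compl; first exact: measurable_quad_form_le.
  - exact: (measurable_quad_form_gt z (4 * eps * K ^+ 2 * l2norm z ^+ 2)).
  - by move=> t /= /negP; rewrite -ltNge.
  - apply: le_trans (quad_form_tail N_gt0 mw indep wK z K0 e0) _.
    rewrite lee_fin ler_pM2l// ler_expR !mulNr lerN2 ler_wpM2r//.
    lra.
have mG : measurable [set t | opnorm (D t) <= 4 * eps * K ^+ 2].
  by apply: measurable_opnorm_le => //; exact: measurable_deviation_entry.
(* If n log 9 dominates, the exponential is at least 1 and the claimed lower bound is negative. *)
have [hn|/ltW hn] :=
  leP (n%:R * ln 9) (1280^-1 * Num.min eps (eps ^+ 2) * N%:R); last first.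
  set e := expR _; have e1 : 1 <= e by rewrite -expR0 ler_expR subr_ge0.
  apply: le_trans (measure_ge0 P _); rewrite lee_fin.
  by move: e1; move: (e) => x; lra.
pose B (phi : grid_index n) := [set t |
  4 * (eps / 2) * K ^+ 2 * l2norm (grid_point R phi) ^+ 2 <
    `|((grid_point R phi)^T *m D t *m grid_point R phi) 0 0|].
have mB phi : measurable (B phi) by exact: measurable_quad_form_gt.
apply: (probability_ge_compl mG (B := \bigcup_(phi in [set` enum (grid_net n)]) B phi)).
- by apply: fin_bigcup_measurable => // phi _; exact: mB.
(* Outside all bad events the net lemma applies with tau = 4 (eps/2) K^2, and 2 tau is exactly the
   target. *)
- move=> t /= /negP; rewrite -ltNge => hD; apply: contrapT => hB.
  have := @opnorm_le_grid_net R n n_gt0 (D t) (4 * (eps / 2) * K ^+ 2)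
    (second_moment_deviation_sym t) _ _.
  have -> : 2 * (4 * (eps / 2) * K ^+ 2) = 4 * eps * K ^+ 2 by field.
  move: hD; rewrite ltNge => /negP hD h; apply/hD/h.
    by rewrite !mulr_ge0 ?sqr_ge0// ltW.
  move=> phi phiS; rewrite leNgt; apply/negP => Bphi; apply: hB.
  by exists phi => //=; rewrite mem_enum.
- have e20 : 0 < eps / 2 by rewrite divr_gt0.
  apply: le_trans (probability_bigcup_seq_le _ mB
    (fun phi => quad_form_tail N_gt0 mw indep wK _ K0 e20)) _.
  rewrite -cardE lee_fin; apply: le_trans (expR_union_bound e0 hn).
  by rewrite ler_wpM2r ?mulr_ge0 ?expR_ge0// card_grid_net.
Qed.

End deviation_bounds.

Theorem mainTheorem1 (R : realType) :
  exists c : R, 0 < c /\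
  forall (d : measure_display) (T : measurableType d) (P : probability T R)
    (n N : nat) (w : 'I_N -> T -> 'cV[R]_n) (K : R),
    (1 <= n)%N -> (1 <= N)%N ->
    (forall j, random_vector (w j)) ->
    mutually_independent P w ->
    (forall j, sub_gaussian_vector P (w j)) ->
    (forall j, (sub_gaussian_vector_norm P (w j) <= K%:E)%E) ->
    forall eps : R, 0 < eps ->
      (forall z : 'cV[R]_n,
        ((1 - 2 * expR (- c * Num.min eps (eps ^+ 2) * N%:R))%:E <=
         P [set t | (`| (z^T *m second_moment_deviation P w t *m z) 0 0 |
                     <= 4 * eps * K ^+ 2 * l2norm z ^+ 2)%R])%E)
      /\
      ((1 - 2 * expR (n%:R * ln 9 - c * Num.min eps (eps ^+ 2) * N%:R))%:E <=
       P [set t | (opnorm (second_moment_deviation P w t)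
                   <= 4 * eps * K ^+ 2)%R])%E.
Proof.
exists 1280^-1; split; first by rewrite invr_gt0 ltr0n.
move=> d T P n N w K n_gt0 N_gt0 mw indep _ wK eps e0.
(* A single direction of a single vector, available as n, N >= 1, forces the sign of K. *)
have K_ge0 : 0 <= K.
  rewrite -lee_fin; apply: le_trans (wK (Ordinal N_gt0)).
  pose e : 'cV[R]_n := delta_mx (Ordinal n_gt0) 0.
  apply: (@le_trans _ _ (sub_gaussian_norm P
    (fun t => dotv (w (Ordinal N_gt0) t) e))); first exact: sub_gaussian_norm_ge0.
  by apply: ereal_sup_ubound; exists e => //=; exact: l2norm_delta.
move: K_ge0; rewrite le_eqVlt => /predU1P[K0|K_gt0]; last first.
  exact: deviation_bounds_pos.
(* For K = 0 every positive [K'] bounds the norms too; the probabilities stay fixed while the events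
   shrink. *)
have wKpos (K' : R) : 0 < K' ->
    forall j, (sub_gaussian_vector_norm P (w j) <= K'%:E)%E.
  by move=> K'0 j; rewrite (le_trans (wK j))// lee_fin -K0 ltW.
rewrite -K0 expr0n mulr0; split => [z|].
  rewrite mul0r; apply: (probability_le0_limit (a := 4 * eps * l2norm z ^+ 2)).
    by move=> c; exact: measurable_quad_form_le.
  move=> K' K'0; rewrite (mulrAC _ (l2norm z ^+ 2)).
  exact: (deviation_bounds_pos n_gt0 N_gt0 mw indep K'0 e0 (wKpos _ K'0)).1.
apply: (probability_le0_limit (a := 4 * eps)).
  move=> c; apply: measurable_opnorm_le => // i k.
  exact: measurable_deviation_entry.
move=> K' K'0.
exact: (deviation_bounds_pos n_gt0 N_gt0 mw indep K'0 e0 (wKpos _ K'0)).2.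
Qed.
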